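(* For all integers $n \geq 1$, $$\chi(n) = \frac{\operatorname{HW}(M(f, n, n, n+4))}{n+4} - n^2,$$ where $f(n,x,y) = (x^2 - ny)^2$.
   Context: For $n \geq 1$, $\chi(n) = \max\{ s \in \mathbb{N} : s^2 \mid n \}$. $\operatorname{HW}(N)$ is the Hamming weight of $N$, i.e. the number of $1$s in the binary representation of $N$. For integers $a, b$ with $0 \leq a < 2^b$, put $\delta(a,b) = (2^b - 1)(2^b - a + 1)$. For positive integers $t,u$ such that $0 \le f(n,x,y) < 2^u$ for all integers $x,y\in[0,t-1]$, define $$M(f,n,t,u) = \sum_{x=0}^{t-1}\sum_{y=0}^{t-1} 2^{2u(x + y t)}\, \delta(f(n,x,y), u).$$ In the claim, $t = n$ and $u = n+4$. *)

(* Defs.v *)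
From mathcomp Require Import all_boot all_order all_algebra.
Set Implicit Arguments.
Unset Strict Implicit.
Unset Printing Implicit Defensive.
Import Order.TTheory GRing.Theory Num.Theory.
Local Open Scope ring_scope.

(* Every s with s ^ 2 %| n satisfies s <= n when n > 0, so the bound on s only
   makes the maximum finite; the value at n = 0 is meaningless. *)
Definition chi (n : nat) : nat := (\max_(s < n.+1 | s ^ 2 %| n) s)%N.

(* Least significant digit first, without leading zeros (a single digit 0 for
   N = 0). *)
Definition binary_digits (N : nat) : seq bool :=
  [seq odd (N %/ 2 ^ i)%N | i <- iota 0 (trunc_log 2 N).+1].

Definition HW (N : nat) : nat := count id (binary_digits N).

(* Intended for 0 <= a < 2 ^+ b. *)
Definition delta (a : int) (b : nat) : int :=
  (2 ^+ b - 1) * (2 ^+ b - a + 1).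

(* The condition under which M f n t u is defined. *)
Definition M_defined (f : int -> int -> int -> int) (n : int) (t u : nat)
    : Prop :=
  [/\ (0 < t)%N, (0 < u)%N &
    forall x y : int, 0 <= x <= t%:Z - 1 -> 0 <= y <= t%:Z - 1 ->
      0 <= f n x y < 2 ^+ u].

(* A nonnegative integer whenever M_defined f n t u holds. *)
Definition M (f : int -> int -> int -> int) (n : int) (t u : nat) : int :=
  \sum_(0 <= x < t) \sum_(0 <= y < t)
    2 ^+ (2 * u * (x + y * t)) * delta (f n x%:Z y%:Z) u.

(* Main.v *)
Require Import Defs.
From mathcomp Require Import all_boot all_order all_algebra.
From mathcomp Require Import zify ring.
Set Implicit Arguments.
Unset Strict Implicit.
Unset Printing Implicit Defensive.
Import Order.TTheory GRing.Theory Num.Theory.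
Local Open Scope ring_scope.

(** [M] concatenates [n ^ 2] blocks of [2 * u] bits, one per pair [(x, y)].
    Such a block has weight [2 * u] if [f n x y = 0], being
    [2 ^ (2 * u) - 1], and weight [u] otherwise, since its upper half is then
    some [m < 2 ^ u] and its lower half the bitwise complement of [m].  So
    [HW M / u - n ^ 2] counts the solutions of [x ^ 2 = n * y], that is, the
    [x < n] with [n %| x ^ 2].  Writing [n = chi n ^ 2 * k] with [k]
    squarefree, these are the [chi n] multiples of [chi n * k] below [n]. *)

(** Leading zeros add no weight, so any sufficient length [k] may be used, and weights of different
    numbers can be compared digit by digit. *)
Lemma HW_sum (k N : nat) :
  (N < 2 ^ k)%N -> HW N = (\sum_(i < k) odd (N %/ 2 ^ i))%N.
Proof.
move=> ltNk; pose F i : nat := odd (N %/ 2 ^ i).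
have zeroF i : (N < 2 ^ i)%N -> F i = 0%N by move=> lt; rewrite /F divn_small.
have tail a b : (N < 2 ^ a)%N -> (a <= b)%N ->
    (\sum_(0 <= i < b) F i = \sum_(0 <= i < a) F i)%N.
  move=> lta leab; rewrite (@big_cat_nat _ _ _ a) //=.
  rewrite -[RHS]addn0; congr addn; rewrite big_nat big1 // => i /andP[leai _].
  by apply: zeroF; apply: leq_trans lta _; rewrite leq_exp2l.
have -> : HW N = (\sum_(0 <= i < (trunc_log 2 N).+1) F i)%N.
  rewrite /HW /binary_digits count_map -sum1_count big_mkcond.
  by apply: eq_bigr => i _; rewrite /F /=; case: odd.
rewrite -(big_mkord xpredT F).
have ltN : (N < 2 ^ (trunc_log 2 N).+1)%N by rewrite trunc_log_ltn.
by case: (leqP k (trunc_log 2 N).+1) => [/tail->//|/ltnW/tail->].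
Qed.

Lemma HW0 : HW 0 = 0%N.
Proof. by rewrite (@HW_sum 0) // big_ord0. Qed.

(** The addition produces no carry: the low [a] digits are those of [N], the higher ones those of
    [q]. *)
Lemma HW_concat (a N q : nat) :
  (N < 2 ^ a)%N -> HW (N + 2 ^ a * q) = (HW N + HW q)%N.
Proof.
move=> ltN; have ltq : (q < 2 ^ q)%N by rewrite ltn_expl.
have ltNq : (N + 2 ^ a * q < 2 ^ (a + q))%N.
  rewrite expnD; apply: (@leq_trans (2 ^ a * q.+1)).
    by rewrite mulnS ltn_add2r.
  by rewrite leq_mul2l ltq orbT.
rewrite (HW_sum ltNq) (HW_sum ltN) (HW_sum ltq) big_split_ord /=.
have a_gt0 : (0 < 2 ^ a)%N by rewrite expn_gt0.
congr (_ + _)%N; apply: eq_bigr => i _; last first.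
  by rewrite expnD divnMA mulnC addnC divnMDl // (divn_small ltN) addn0.
(* As [i < a], the summand [2 ^ a * q] is an even multiple of [2 ^ i] and leaves the parity of the
   quotient unchanged. *)
have -> : (2 ^ a * q = 2 ^ (a - i).-1 * q * 2 * 2 ^ i)%N.
  have lt_ia := ltn_ord i.
  have {1}-> : a = ((a - i).-1 + 1 + i)%N by lia.
  by rewrite !expnD expn1; ring.
by rewrite addnC divnMDl ?expn_gt0 // oddD oddM /= andbF.
Qed.

Lemma digits_lt (w t : nat) (d : nat -> nat) :
  (forall i, (i < t)%N -> (d i < 2 ^ w)%N) ->
  (\sum_(0 <= i < t) 2 ^ (w * i) * d i < 2 ^ (w * t))%N.
Proof.
elim: t => [|t IHt] ltd; first by rewrite big_geq // muln0.
have /IHt {}IHt i : (i < t)%N -> (d i < 2 ^ w)%N by move=> /ltnW/ltd.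
rewrite big_nat_recr //= mulnSr expnD.
apply: (@leq_trans (2 ^ (w * t) * (d t).+1)).
  by rewrite mulnS ltn_add2r.
by rewrite leq_mul2l ltd ?orbT.
Qed.

Lemma HW_digits (w t : nat) (d : nat -> nat) :
  (forall i, (i < t)%N -> (d i < 2 ^ w)%N) ->
  HW (\sum_(0 <= i < t) 2 ^ (w * i) * d i) = (\sum_(0 <= i < t) HW (d i))%N.
Proof.
elim: t => [|t IHt] ltd; first by rewrite !big_geq // HW0.
have ltd' i : (i < t)%N -> (d i < 2 ^ w)%N by move=> /ltnW/ltd.
by rewrite !big_nat_recr //= HW_concat ?IHt //; apply: digits_lt.
Qed.

(** Subtracting from [b] ones never borrows, so it flips every digit. The induction peels off the
    lowest digit. *)
Lemma HW_compl (b m : nat) :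
  (m < 2 ^ b)%N -> (HW m + HW (2 ^ b - 1 - m))%N = b.
Proof.
elim: b m => [|b IHb] m ltm.
  by have -> : m = 0%N by [lia]; rewrite HW0.
have HWbit (c : bool) q : HW (c + 2 ^ 1 * q) = (c + HW q)%N.
  by rewrite HW_concat; case: c => //=; rewrite HW0.
have em : m = (odd m + 2 ^ 1 * m./2)%N by rewrite expn1 mul2n odd_double_half.
rewrite expnS in ltm *.
have lth : (m./2 < 2 ^ b)%N by lia.
have -> : (2 * 2 ^ b - 1 - m = ~~ odd m + 2 ^ 1 * (2 ^ b - 1 - m./2))%N.
  rewrite expn1; move: em; rewrite expn1; case: (odd m) => /=; lia.
by rewrite {1}em !HWbit; have := IHb _ lth; case: (odd m) => /=; lia.
Qed.

Lemma HW_delta (a b : nat) : (a < 2 ^ b)%N ->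
  HW ((2 ^ b - 1) * (2 ^ b - a + 1)) = (b + b * (a == 0))%N.
Proof.
move=> lta; have HWmax c : HW (2 ^ c - 1) = c.
  by have := @HW_compl c 0; rewrite HW0 subn0 add0n => -> //; rewrite expn_gt0.
case: eqP => [->|/eqP a0].
  have -> : ((2 ^ b - 1) * (2 ^ b - 0 + 1) = 2 ^ (b + b) - 1)%N.
    by rewrite expnD; nia.
  by rewrite HWmax muln1.
(* With [m = 2 ^ b - a], this is [(2 ^ b - 1) * (m + 1) = (2 ^ b - 1 - m) + 2 ^ b * m], and [a != 0]
   makes [m] fit in [b] bits. *)
have -> : ((2 ^ b - 1) * (2 ^ b - a + 1)
    = (2 ^ b - 1 - (2 ^ b - a)) + 2 ^ b * (2 ^ b - a))%N by nia.
by rewrite HW_concat ?muln0 ?addn0 1?addnC ?HW_compl //; lia.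
Qed.

Lemma delta_lt (a b : nat) : (a < 2 ^ b)%N ->
  ((2 ^ b - 1) * (2 ^ b - a + 1) < 2 ^ (2 * b))%N.
Proof. by move=> lta; rewrite mul2n -addnn expnD; nia. Qed.

Lemma PoszX (a b : nat) : (a ^ b)%N%:Z = a%:Z ^+ b.
Proof. by rewrite -!natz natrX. Qed.

Lemma deltaE (a b : nat) : (a < 2 ^ b)%N ->
  delta a%:Z b = ((2 ^ b - 1) * (2 ^ b - a + 1))%N%:Z.
Proof.
move=> lta; rewrite /delta PoszM PoszD -!subzn ?expn_gt0 //; last exact: ltnW.
by rewrite PoszX.
Qed.

(** In the exponent [2 * u * (x + y * t)] the index [x] varies fastest. Hence the swapped sums: each
    row [y] is one digit in base [2 ^ (2 * u * t)], itself expanded in base [2 ^ (2 * u)]. The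
    function [g] carries the values of [f] over to [nat]. *)
Lemma ME (f : int -> int -> int -> int) (n : int) (t u : nat)
    (g : nat -> nat -> nat) :
  (forall x y, (x < t)%N -> (y < t)%N ->
     f n x%:Z y%:Z = (g x y)%:Z /\ (g x y < 2 ^ u)%N) ->
  HW `|M f n t u|%N
  = (\sum_(0 <= y < t) \sum_(0 <= x < t) (u + u * (g x y == 0)))%N.
Proof.
move=> fE; pose d x y := ((2 ^ u - 1) * (2 ^ u - g x y + 1))%N.
have -> : M f n t u = (\sum_(0 <= y < t) 2 ^ (2 * u * t * y) *
    (\sum_(0 <= x < t) 2 ^ (2 * u * x) * d x y))%N%:Z.
  rewrite /M exchange_big /= -[RHS]natz natr_sum !big_nat.
  apply: eq_bigr => y /andP[_ lty].
  rewrite natrM natr_sum mulr_sumr !big_nat; apply: eq_bigr => x /andP[_ ltx].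
  have [-> ltg] := fE x y ltx lty.
  rewrite deltaE // -/(d x y) -natz [in RHS]natrM !natrX mulrA -exprD.
  by congr (_ ^+ _ * _); ring.
rewrite absz_nat HW_digits => [|y lty].
  rewrite !big_nat; apply: eq_bigr => y /andP[_ lty].
  rewrite HW_digits => [|x ltx].
    rewrite !big_nat; apply: eq_bigr => x /andP[_ ltx].
    by rewrite HW_delta //; case: (fE x y ltx lty).
  by apply: delta_lt; case: (fE x y ltx lty).
apply: digits_lt => x ltx.
by apply: delta_lt; case: (fE x y ltx lty).
Qed.

Lemma chi_max (n s : nat) : (0 < n)%N -> (s ^ 2 %| n)%N -> (s <= chi n)%N.
Proof.
move=> n0 ds; have lts : (s < n.+1)%N.
  rewrite ltnS; apply: leq_trans (dvdn_leq n0 ds).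
  by rewrite -mulnn; nia.
by rewrite /chi (@leq_bigmax_cond _ _ _ (Ordinal lts)).
Qed.

Lemma chi_sqr_dvd (n : nat) : (0 < n)%N -> (chi n ^ 2 %| n)%N.
Proof.
(* The candidate [1] makes the range nonempty, so the maximum is attained. *)
move=> n0; have lt1 : (1 < n.+1)%N by [].
have [|i di chiE] :=
    @eq_bigmax_cond _ (fun s : 'I_n.+1 => s ^ 2 %| n)%N (@nat_of_ord _).
  by apply/card_gt0P; exists (Ordinal lt1); rewrite unfold_in /= exp1n dvd1n.
by rewrite (chiE : chi n = i).
Qed.

Lemma dvdn_sqr_chi (n x : nat) : (0 < n)%N ->
  (n %| x ^ 2)%N = (n %/ chi n %| x)%N.
Proof.
move=> n0; have /dvdnP[k nE] := chi_sqr_dvd n0.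
set s := chi n in nE *.
have [k0 s0] : (0 < k)%N /\ (0 < s)%N by nia.
have -> : (n %/ s = k * s)%N by rewrite nE -mulnn mulnA mulnK.
apply/idP/idP => [dx|/dvdnP[c ->]]; last first.
  by rewrite nE; apply/dvdnP; exists (c ^ 2 * k)%N; ring.
have /dvdnP[z xE] : (s %| x)%N.
  by rewrite -(@dvdn_pexp2r _ _ 2) //; apply: dvdn_trans dx; rewrite nE dvdn_mull.
move: dx; rewrite xE nE expnMn !dvdn_pmul2r ?expn_gt0 ?s0 // => dz.
(* It remains to deduce [k %| z] from [k %| z ^ 2]. With [k = a * g], [z = b * g] and [a], [b]
   coprime, [a] divides [g], so [a ^ 2 %| k] and [(a * s) ^ 2 %| n]; maximality of [s] forces
   [a = 1]. *)
set g := gcdn k z.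
have g0 : (0 < g)%N by rewrite gcdn_gt0 k0.
have /dvdnP[a kE] : (g %| k)%N := dvdn_gcdl k z.
have /dvdnP[b zE] : (g %| z)%N := dvdn_gcdr k z.
have cab : coprime a b.
  rewrite /coprime; apply/eqP/eqP; rewrite -(eqn_pmul2r g0) muln_gcdl mul1n.
  by rewrite -kE -zE.
have dag : (a %| g)%N.
  move: dz; rewrite {1}kE zE.
  have -> : ((b * g) ^ 2 = b ^ 2 * g * g)%N by ring.
  by rewrite dvdn_pmul2r // Gauss_dvdr // coprimeXr.
have /chi_max : ((a * s) ^ 2 %| n)%N.
  by rewrite nE kE expnMn dvdn_mul // -mulnn dvdn_mul.
rewrite -/s => /(_ n0); rewrite -{2}[s]mul1n leq_pmul2r // => le_a1.
have a0 : (0 < a)%N by move: k0; rewrite kE muln_gt0 => /andP[].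
have a1 : a = 1%N by apply/eqP; rewrite eqn_leq le_a1.
by rewrite kE a1 mul1n dvdn_gcdr.
Qed.

Lemma count_dvdn (d n : nat) : (d %| n)%N ->
  (\sum_(0 <= x < n) (d %| x))%N = (n %/ d)%N.
Proof.
(* The quotient counts multiples in [1..n] rather than [0..n-1]; both ends [0] and [n] are multiples
   of [d], so they can be traded. *)
move=> dn; apply: (@addIn 1); rewrite divn_count_dvd.
transitivity (\sum_(0 <= x < n.+1) (d %| x))%N.
  by rewrite big_nat_recr //= dn.
by rewrite big_nat_recl // dvdn0 addnC big_add1.
Qed.

(** This is why [n + 4] bits suffice: for [x, y < n], both [x ^ 2] and [n * y] lie between [0] and
    [n * n.-1], and so does the distance between them. *)
Lemma max_value_lt (n : nat) : ((n * n.-1) ^ 2 < 2 ^ (n + 4))%N.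
Proof.
(* The induction starts at [6], the first [n] with [(n + 1) ^ 2 <= 2 * (n - 1) ^ 2]; smaller cases
   are computed. *)
have [lt6|] := ltnP n 6; first by move: n lt6; do 6?[case=> //].
elim: n => // n IHn; rewrite leq_eqVlt => /orP[/eqP<- //|le6].
have sqr_le : (n.+1 ^ 2 <= 2 * n.-1 ^ 2)%N by rewrite -!mulnn; nia.
rewrite addSn [X in (_ < X)%N]expnS.
apply: (@leq_ltn_trans (2 * (n * n.-1) ^ 2)).
  by rewrite mulnC !expnMn mulnCA leq_mul2l sqr_le orbT.
by rewrite ltn_pmul2l // IHn.
Qed.

Theorem theorem5p1 (n : nat) (f : int -> int -> int -> int)
    (hn : (1 <= n)%N)
    (hf : forall m x y : int, f m x y = (x ^+ 2 - m * y) ^+ 2) :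
  M_defined f n%:Z n (n + 4) /\
  ((chi n)%:R = (HW `|M f n%:Z n (n + 4)|%N)%:R / (n + 4)%:R - n%:R ^+ 2 :> rat).
Proof.
pose e (x y : nat) : int := x%:Z ^+ 2 - n%:Z * y%:Z.
have fE x y : f n%:Z x%:Z y%:Z = (`|e x y| ^ 2)%N%:Z.
  by rewrite hf PoszX abszE real_normK ?num_real.
have f_lt x y : (x < n)%N -> (y < n)%N -> (`|e x y| ^ 2 < 2 ^ (n + 4))%N.
  move=> ltx lty; apply: leq_ltn_trans (max_value_lt n).
  have : (`|e x y| <= n * n.-1)%N by rewrite /e expr2; nia.
  by rewrite leq_exp2r.
split.
  split=> //; first by rewrite addn4.
  case=> [x|x] [y|y] //; move=> hx hy; rewrite fE.
  have := @f_lt x y; have : (2 ^ (n + 4))%N%:Z = 2 ^+ (n + 4) :> int. by exact: PoszX.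
  lia.
have -> := @ME f n n (n + 4) (fun x y => `|e x y| ^ 2)%N; last first.
  by move=> x y ltx lty; split; [exact: fE | exact: f_lt].
have e0 x y : (`|e x y| ^ 2 == 0)%N = (x ^ 2 == n * y)%N.
  by rewrite expn_eq0 andbT absz_eq0 subr_eq0 -!natz -natrX -natrM eqr_nat.
(* The only possible [y] is the quotient of [x ^ 2] by [n], which is below [n] because [x < n]. *)
have row x : (x < n)%N -> (\sum_(0 <= y < n) (x ^ 2 == n * y) = (n %| x ^ 2))%N.
  move=> ltx; have [/dvdnP[q xE]|ndx] := boolP (n %| x ^ 2)%N; last first.
    rewrite big1 // => y _; case: eqP => // xE.
    by rewrite xE dvdn_mulr in ndx.
  have ltq : (q < n)%N by nia.
  rewrite (bigD1_seq q) ?mem_index_iota ?iota_uniq //= xE mulnC eqxx big1 // => y neq.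
  by rewrite eqn_pmul2l // eq_sym (negPf neq).
have cdvd : (chi n %| n)%N by apply: dvdn_trans (chi_sqr_dvd hn); rewrite dvdn_exp.
(* Each of the [n ^ 2] pairs contributes [n + 4], and each zero of [e] another [n + 4]; the zeros
   correspond to the [chi n] multiples of [n %/ chi n] below [n]. *)
have -> : (\sum_(0 <= y < n) \sum_(0 <= x < n)
    (n + 4 + (n + 4) * (`|e x y| ^ 2 == 0)) = (n + 4) * (n ^ 2 + chi n))%N.
  rewrite exchange_big /=.
  have -> : (\sum_(0 <= x < n) \sum_(0 <= y < n)
      (n + 4 + (n + 4) * (`|e x y| ^ 2 == 0))
    = \sum_(0 <= x < n) ((n + 4) * n + (n + 4) * (n %/ chi n %| x)))%N.
    rewrite !big_nat; apply: eq_bigr => x /andP[_ ltx].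
    rewrite big_split /= sum_nat_const_nat subn0 mulnC -big_distrr /=.
    rewrite -dvdn_sqr_chi // -row //; congr (_ + _ * _)%N.
    by apply: eq_bigr => y _; rewrite e0.
  rewrite big_split /= sum_nat_const_nat subn0 -big_distrr /= count_dvdn.
    by rewrite divnA // mulKn //; ring.
  exact: dvdn_div.
have n4 : (n + 4)%:R != 0 :> rat by rewrite pnatr_eq0 addn4.
by rewrite natrM mulrAC mulfV // mul1r natrD natrX addrAC subrr add0r.
Qed.
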